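(* Let $\kappa$ be an (infinite) regular cardinal. Then $\mathfrak{t}_\kappa \le \mathfrak{b}_\kappa$.
   Context: Let $\kappa$ be a regular (infinite) cardinal. $[\kappa]^\kappa=\{X\subseteq\kappa : |X|=\kappa\}$ and $\kappa^\kappa$ is the set of functions $f:\kappa\to\kappa$. For $A,B\in[\kappa]^\kappa$, $A\subset^* B$ means $|A\setminus B|<\kappa$ and $|B\setminus A|=\kappa$. For $f,g\in\kappa^\kappa$, $f<^* g$ means $\exists\beta<\kappa\,\forall\alpha>\beta\ (f(\alpha)<g(\alpha))$, with $\alpha<\kappa$. A set $\mathcal B\subseteq\kappa^\kappa$ is $<^*$-unbounded if for every $f\in\kappa^\kappa$ there is $g\in\mathcal B$ with $g\not<^* f$. $\mathfrak b_\kappa$ is the least cardinality of a $<^*$-unbounded $\mathcal B\subseteq\kappa^\kappa$. $\mathfrak t_\kappa$ is the least cardinality $|\mathcal T|$ of a set $\mathcal T\subseteq[\kappa]^\kappa$ such that: $|\mathcal T|\ge\kappa$; $\mathcal T$ is well ordered by $\subset^*$; and for every $C\in[\kappa]^\kappa$ with $|\kappa\setminus C|=\kappa$ there is $A\in\mathcal T$ with $|A\setminus C|=\kappa$. *)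

(* Defs.v *)
(* MathComp / MathComp-Analysis (classical layer). *)
From mathcomp Require Import all_boot all_order.
From mathcomp Require Import boolp classical_sets functions cardinality wochoice.

Set Implicit Arguments.
Unset Strict Implicit.
Unset Printing Implicit Defensive.

Import Order.TTheory.
Local Open Scope order_scope.
Local Open Scope classical_set_scope.
Local Open Scope card_scope.

Definition card_lt {T U : Type} (A : set T) (B : set U) : Prop :=
  A #<= B /\ ~ (B #<= A).

(* A cardinal is an initial ordinal.  Up to isomorphism it is a well-ordered
   type all of whose proper initial segments have smaller cardinality; the
   points of K are then the ordinals below it. *)
Definition is_cardinal {d : Order.disp_t} (K : orderType d) : Prop :=
  well_order (<=%O : rel K) /\
  forall a : K, card_lt [set x : K | x < a] [set: K].

Definition regular_cardinal {d : Order.disp_t} (K : orderType d) : Prop :=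
  [/\ is_cardinal K,
      infinite_set [set: K]
    & forall X : set K, (forall a : K, exists2 x, X x & a <= x) ->
        X #= [set: K]].

Section CardinalCharacteristics.
Context {d : Order.disp_t} (K : orderType d).
Implicit Types (A B C : set K) (f g : K -> K).

Definition full_subset A : Prop := A #= [set: K].

Definition almost_ssubset A B : Prop :=
  card_lt (A `\` B) [set: K] /\ B `\` A #= [set: K].

Definition eventually_lt f g : Prop :=
  exists b : K, forall a : K, b < a -> f a < g a.

Definition unbounded_family (F : set (K -> K)) : Prop :=
  forall f, exists2 g, F g & ~ eventually_lt g f.

End CardinalCharacteristics.

Definition well_ordered_by {T : Type} (R : T -> T -> Prop) (S : set T) : Prop :=
  [/\ forall x, S x -> ~ R x x,
      forall x y z, S x -> S y -> S z -> R x y -> R y z -> R x z,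
      forall x y, S x -> S y -> [\/ x = y, R x y | R y x]
    & forall S' : set T, S' `<=` S -> S' !=set0 ->
        exists2 m, S' m & forall x, S' x -> x = m \/ R m x].

Definition tower {d : Order.disp_t} (K : orderType d) (T : set (set K)) : Prop :=
  [/\ T `<=` @full_subset d K,
      [set: K] #<= T,
      well_ordered_by (@almost_ssubset d K) T
    & forall C : set K, full_subset C -> ~` C #= [set: K] ->
        exists2 A, T A & A `\` C #= [set: K]].

(* There is no type of cardinals: a least cardinality is represented by any
   set that realizes it, which is unique up to equipotence. *)
Definition least_card {T : Type} (P : set T -> Prop) (S : set T) : Prop :=
  P S /\ forall S' : set T, P S' -> S #<= S'.

Definition represents_t {d : Order.disp_t} (K : orderType d) :
  set (set K) -> Prop := least_card (@tower d K).

Definition represents_b {d : Order.disp_t} (K : orderType d) :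
  set (K -> K) -> Prop := least_card (@unbounded_family d K).

(* Main.v *)
(* If t > |F| for an unbounded family F, follow a well-ordering of F and choose
   sets C_f, increasing for almost inclusion, whose complements D_f are
   f-sparse: f z < y whenever x < y are in D_f and z <= x.  The construction
   never gets stuck, since fewer than t sets never form a tower.  For the same
   reason some unbounded D is almost contained in every D_f, and then the
   function sending a to the larger of two points of D above a eventually
   dominates all of F.

   As families of size less than kappa do not count as towers, the chain starts
   with kappa many sets fixed in advance.  To keep its size at most |F|, their
   indices are borrowed from F: kappa many members of F have a common bound f0,
   and they are all dealt with at once by placing the complements of the
   initial chain inside an f0-sparse set. *)
Require Import Defs.
From mathcomp Require Import all_boot all_order.
From mathcomp Require Import boolp classical_sets functions cardinality wochoice.

Set Implicit Arguments.
Unset Strict Implicit.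
Unset Printing Implicit Defensive.

Import Order.TTheory.
Local Open Scope order_scope.
Local Open Scope classical_set_scope.
Local Open Scope card_scope.

(** * Cardinal comparison and least cardinalities *)

(** Injections are handled as relations that need not be single-valued; this avoids subtypes and
    default values, and choice recovers a function. *)
Lemma card_le_relP {T U : Type} (A : set T) (B : set U) :
  A #<= B <-> exists r : T -> U -> Prop,
    (forall x, A x -> exists2 y, B y & r x y) /\
    (forall x x' y, r x y -> r x' y -> x = x').
Proof.
split=> [/card_leP[f]|[r [rtot rinj]]].
  exists (fun x y => exists u : A, val u = x /\ val (f u) = y); split.
    move=> x Ax; exists (val (f (SigSub (mem_set Ax)))).
      exact/set_mem/(valP (f _)).
    by exists (SigSub (mem_set Ax)).
  move=> x x' y [u [<- <-]] [v [<- /val_inj fvu]].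
  by congr val; apply: esym; apply: inj fvu; rewrite inE.
have g (u : A) : {v : B | r (val u) (val v)}.
  apply: cid; have [y By ry] := rtot _ (set_mem (valP u)).
  by exists (SigSub (mem_set By)).
apply/card_leP/injfunPex; exists (fun u => projT1 (g u)) => // u v _ _ guv.
apply: val_inj; apply: rinj (projT2 (g u)) _;
by rewrite guv; exact: (projT2 (g v)).
Qed.

Lemma card_le_setU {T U : Type} (A1 A2 : set T) (B1 B2 : set U) :
  A1 #<= B1 -> A2 #<= B2 -> B1 `&` B2 = set0 -> A1 `|` A2 #<= B1 `|` B2.
Proof.
move=> /card_le_relP[r1 [t1 i1]] /card_le_relP[r2 [t2 i2]] B120.
have B12 y : B1 y -> B2 y -> False.
  by move=> B1y B2y; have : (B1 `&` B2) y by []; rewrite B120.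
apply/card_le_relP.
exists (fun x y => (B1 y /\ r1 x y) \/ (B2 y /\ r2 x y)); split.
  by move=> x [/t1|/t2] [y By rxy]; exists y;
    [left|left|right|right].
move=> x x' y [[By rx]|[By rx]] [[By' rx']|[By' rx']].
- exact: i1 rx rx'.
- by case: (B12 y).
- by case: (B12 y).
- exact: i2 rx rx'.
Qed.

(* A maximal family of choice functions on P no two of which agree anywhere
   must exhaust some S in P; evaluation then injects S into every member. *)
Lemma ex_least_card {T : Type} (P : set T -> Prop) :
  (exists S, P S) -> exists S, least_card P S.
Proof.
move=> [S0 PS0].
pose good (X : set (set T -> T)) :=
  (forall F, X F -> forall S, P S -> S (F S)) /\
  (forall F G S, X F -> X G -> P S -> F S = G S -> F = G).
have [|X [[Xin Xinj] Xmax]] := @Zorn_bigcup _ good.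
  move=> FF FFgood FFtot.
  split=> [F [X /FFgood[Xin _] /Xin]//|F G S [X FFX XF] [Y FFY YG] PS FG].
  have [XY|YX] := FFtot _ _ FFX FFY.
  - by have [_ /(_ _ _ S (XY _ XF) YG)->] := FFgood _ FFY.
  - by have [_ /(_ _ _ S XF (YX _ YG))->] := FFgood _ FFX.
have [[S PS SX]|noS] :=
    pselect (exists2 S, P S & forall s, S s -> exists2 F, X F & F S = s).
  exists S; split=> // S' PS'; apply/card_le_relP.
  exists (fun s s' => exists F, [/\ X F, F S = s & F S' = s']); split.
    by move=> s /SX[F XF <-]; exists (F S'); [exact: (Xin F XF)|exists F].
  move=> s t s' [F [XF <- <-]] [G [XG <- GF]].
  by rewrite (Xinj F G _ XF XG PS' (esym GF)).
have miss S : P S -> exists2 s, S s & forall F, X F -> F S <> s.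
  move=> PS; apply: contrapT => no; apply: noS; exists S => // s Ss.
  apply: contrapT => nos; apply: no; exists s => // F XF Fs.
  by apply: nos; exists F.
have [t _ _] := miss _ PS0.
(* [F] picks a missed value in each member of [P], with the arbitrary [t] elsewhere; adjoining it to
   [X] contradicts maximality. *)
have /choice[F FP] S : exists s, P S -> S s /\ forall G, X G -> G S <> s.
  by have [PS|nPS] := pselect (P S); [have [s] := miss _ PS; exists s|exists t].
case: (Xmax (X `|` [set F])).
  split; first by move=> ?; left.
  move=> /(_ F (or_intror erefl)) XF.
  by have [_ /(_ F XF)] := FP _ PS0.
split=> [G [/Xin//|->] S /FP[]//|G H S [XG|->] [XH|->] PS //].
- exact: Xinj.
- by have [_ /(_ _ XG)] := FP _ PS.
- by have [_ /(_ _ XH) ne /esym] := FP _ PS.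
Qed.

(** * Greedy chains by transfinite recursion *)

(** The well-ordering theorem in strict form, so that [Fix] applies. *)
Lemma ex_well_founded (T : Type) : exists lt : T -> T -> Prop,
  well_founded lt /\
  forall P : set T, P !=set0 -> exists2 z, P z & forall x, P x -> x = z \/ lt z x.
Proof.
elim/Pchoice: T => T; have [R Rwo] := well_ordering_principle T.
have Rmin (P : set T) : P !=set0 -> exists2 z, P z & forall x, P x -> R z x.
  move=> [x Px]; have [|z [[Pz zmin] _]] := Rwo (mem P).
    by exists x; apply/mem_set.
  by exists z => [|y Py]; [exact/set_mem|apply/zmin/mem_set].
have Ranti x y : R x y -> R y x -> x = y.
  move=> xy yx; apply: (wo_chain_antisymmetric (withinW Rwo)) => //.
  exact/andP.
exists (fun x y => R x y /\ x <> y); split.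
  move=> x; apply: contrapT => nx.
  have [|z nz zmin] := Rmin [set x | ~ Acc (fun x y => R x y /\ x <> y) x].
    by exists x.
  apply: nz; constructor=> y [yz ne]; apply: contrapT => /zmin zy.
  by apply: ne; exact: Ranti.
move=> P /Rmin[z Pz zmin]; exists z => // x /zmin zx.
by have [->|ne] := pselect (x = z); [left|right; split=> // zx'; apply: ne].
Qed.

Section GreedyChain.
Variables (I U : Type) (R : U -> U -> Prop) (Q : I -> set U).
Hypothesis Rirr : forall x, ~ R x x.
Hypothesis Rtrans : forall x y z, R x y -> R y z -> R x z.

(** Along a well-order of [I], stage [i] picks a member of [Q i] that is [R]-above all earlier
    picks, if there is one. The picks increase, hence are well ordered. If stage [i] fails, no
    member of [Q i] is above the earlier picks, let alone above all of [W]. *)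
Lemma greedy_chain : exists W : set U,
  [/\ well_ordered_by R W,
      W #<= [set i | Q i !=set0],
      W `<=` \bigcup_i Q i
    & forall i, (W `&` Q i) !=set0 \/
        forall c, Q i c -> ~ (forall w, W w -> R w c)].
Proof.
have [lt [ltwf ltmin]] := ex_well_founded I.
pose ok i (D : forall j, lt j i -> option U) c :=
  Q i c /\ forall j ji w, D j ji = Some w -> R w c.
(* [None] marks a stage that is skipped for want of a candidate. *)
pose step i D := if pselect (exists c, @ok i D c) is left e
  then Some (projT1 (cid e)) else None.
pose D := Fix ltwf (fun=> option U) step.
have DE i : D i = step i (fun j _ => D j).
  apply: Fix_eq => j f g fg; congr step.
  apply: functional_extensionality_dep => k.
  exact: functional_extensionality_dep.
have Dsome i c : D i = Some c ->
    Q i c /\ forall j w, lt j i -> D j = Some w -> R w c.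
  rewrite DE /step; case: pselect => // e [<-].
  by have [Qc cabove] := projT2 (cid e); split=> // j w ji; exact: cabove.
have Dnone i c : D i = None -> Q i c ->
    ~ forall j w, lt j i -> D j = Some w -> R w c.
  rewrite DE /step; case: pselect => // ne _ Qc cabove; apply: ne.
  by exists c; split=> // j ji w; exact: cabove.
have ltR i j x y : D i = Some x -> D j = Some y -> lt i j -> R x y.
  by move=> Dx /Dsome[_ jabove] ij; exact: jabove Dx.
exists [set c | exists i, D i = Some c]; split.
- split=> [x _|x y z _ _ _|x y [i Di] [j Dj]|S SW [x Sx]].
  + exact: Rirr.
  + exact: Rtrans.
  + have [|k kij kmin] := ltmin [set i; j]; first by exists i; left.
    have [iE|ki] := kmin i (or_introl erefl);
      have [jE|kj] := kmin j (or_intror erefl).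
    * by constructor 1; move: Di; rewrite iE -jE Dj => -[].
    * by constructor 2; apply: ltR Di Dj _; rewrite iE.
    * by constructor 3; apply: ltR Dj Di _; rewrite jE.
    * case: kij => kE; [constructor 2|constructor 3].
        by apply: ltR Di Dj _; rewrite -kE.
      by apply: ltR Dj Di _; rewrite -kE.
  + have [|i [c Di Sc] imin] := ltmin [set i | exists2 c, D i = Some c & S c].
      by have [i Di] := SW _ Sx; exists i, x.
    exists c => // y Sy; have [j Dj] := SW _ Sy.
    have [|ji|ij] := imin j; first by exists y.
      by left; move: Dj; rewrite ji Di => -[].
    by right; exact: ltR Di Dj ij.
- apply/card_le_relP; exists (fun c i => D i = Some c).
  split=> [c [i Di]|c c' i -> []//].
  by exists i => //; exists c; have [] := Dsome _ _ Di.
- by move=> c [i /Dsome[Qc _]]; exists i.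
- move=> i; case Di : (D i) => [c|].
    by left; exists c; split; [exists i|have [] := Dsome _ _ Di].
  right=> c Qc cabove; apply: Dnone Di Qc _ => j w _ Dj.
  by apply: cabove; exists j.
Qed.

End GreedyChain.

Lemma well_ordered_by_setU {T : Type} (R : T -> T -> Prop) (S1 S2 : set T) :
  (forall x y z, R x y -> R y z -> R x z) ->
  well_ordered_by R S1 -> well_ordered_by R S2 ->
  (forall x y, S1 x -> S2 y -> R x y) -> well_ordered_by R (S1 `|` S2).
Proof.
move=> Rtrans [irr1 _ tot1 min1] [irr2 _ tot2 min2] R12; split.
- by move=> x [/irr1|/irr2].
- by move=> x y z _ _ _; exact: Rtrans.
- move=> x y [Sx|Sx] [Sy|Sy]; [exact: tot1| | |exact: tot2].
    by constructor 2; exact: R12.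
  by constructor 3; exact: R12.
- move=> S SS [x Sx].
  have [[y [Sy S1y]]|no1] := pselect ((S `&` S1) !=set0).
    have [| |m [Sm S1m] mmin] := min1 (S `&` S1).
    - by move=> ? [].
    - by exists y.
    exists m => // z Sz; have [S1z|S2z] := SS _ Sz; first exact: mmin.
    by right; exact: R12.
  apply: min2; last by exists x.
  by move=> z Sz; have [S1z|//] := SS _ Sz; case: no1; exists z.
Qed.

(** * Bounded and cofinal subsets of a regular cardinal *)

Section RegularCardinal.
Context {d : Order.disp_t} (K : orderType d).
Hypothesis regK : regular_cardinal K.
Implicit Types (A B C D X Y : set K) (f g : K -> K).

Definition cofinal X : Prop := forall a, exists2 x, X x & a <= x.

Definition bounded X : Prop := exists a, forall x, X x -> x < a.

Lemma not_cofinal X : ~ cofinal X <-> bounded X.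
Proof.
split=> [nX|[a Xa] /(_ a)[x /Xa xa]]; last by rewrite leNgt xa.
apply: contrapT => nb; apply: nX => a; apply: contrapT => na; apply: nb.
by exists a => x Xx; rewrite ltNge; apply/negP => ax; apply: na; exists x.
Qed.

(** A set that is not cofinal lies in a proper initial segment, which is too small; the converse is
    regularity. Size can thus be replaced by order from here on. *)
Lemma full_cofinal X : full_subset X <-> cofinal X.
Proof.
have [[_ Kseg] _ Kreg] := regK; split; last exact: Kreg.
move=> XK; apply: contrapT => /not_cofinal[a Xa].
have [_] := Kseg a; apply; rewrite -(card_le_eql XK).
exact: subset_card_le.
Qed.

Lemma card_lt_bounded X : card_lt X [set: K] <-> bounded X.
Proof.
rewrite -not_cofinal -full_cofinal /full_subset card_eq_le; split.
  by move=> [_ nKX] /andP[_].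
move=> nXK; split; first exact: card_leT.
by move=> KX; apply: nXK; rewrite card_leT.
Qed.

(** The image of [I] under [g] is too small to be cofinal. *)
Lemma small_bounded {J : Type} (I : set J) (g : J -> K) :
  ~ ([set: K] #<= I) -> exists b, forall i, I i -> g i < b.
Proof.
move=> nKI; have [b gb] : bounded (g @` I).
  apply/card_lt_bounded; split; first exact: card_leT.
  by move=> /card_le_trans /(_ (card_image_le _ _)).
by exists b => i Ii; apply: gb; exists i.
Qed.

Lemma exists_gt (a : K) : exists b, a < b.
Proof.
have [|b /(_ a erefl)] := @small_bounded _ [set a] id; last by exists b.
have [_ Kinf _] := regK.
by move=> Ka; apply: Kinf; exact: card_le_finite Ka (finite_set1 a).
Qed.

Lemma segment_bounded a f : exists b, forall x, x <= a -> f x < b.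
Proof.
have [a' aa'] := exists_gt a; have [[_ /(_ a')[_ Kseg] _ _]] := regK.
have [b fb] := small_bounded f Kseg.
by exists b => x xa; apply: fb; exact: le_lt_trans xa aa'.
Qed.

Lemma cofinal_gt X a : cofinal X -> exists2 x, X x & a < x.
Proof.
move=> cX; have [b ab] := exists_gt a.
by have [x Xx /(lt_le_trans ab)] := cX b; exists x.
Qed.

Lemma cofinalT : cofinal setT.
Proof. by move=> a; exists a. Qed.

Lemma cofinalS X Y : X `<=` Y -> cofinal X -> cofinal Y.
Proof. by move=> XY cX a; have [x /XY Yx ax] := cX a; exists x. Qed.

Lemma boundedS X Y : X `<=` Y -> bounded Y -> bounded X.
Proof. by move=> XY [a Ya]; exists a => x /XY /Ya. Qed.

Lemma ex_point : exists a : K, True.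
Proof.
have [_ Kinf _] := regK; apply: contrapT => na; apply: Kinf.
suff -> : [set: K] = set0 by [].
by apply/seteqP; split=> // x; case: na; exists x.
Qed.

Lemma bounded0 : bounded set0.
Proof. by have [a _] := ex_point; exists a. Qed.

Lemma bounded_setU X Y : bounded X -> bounded Y -> bounded (X `|` Y).
Proof.
move=> [a Xa] [b Yb]; exists (Order.max a b) => x.
by rewrite lt_max => -[/Xa ->|/Yb ->]; rewrite ?orbT.
Qed.

Lemma cofinal_setD X Y : cofinal X -> bounded Y -> cofinal (X `\` Y).
Proof.
move=> cX [b Yb] a; have [x Xx abx] := cX (Order.max a b).
move: abx; rewrite ge_max => /andP[ax bx]; exists x => //; split=> // /Yb.
by rewrite ltNge bx.
Qed.

Lemma almost_ssubsetP A B :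
  almost_ssubset A B <-> bounded (A `\` B) /\ cofinal (B `\` A).
Proof. by rewrite -full_cofinal -card_lt_bounded. Qed.

Lemma almost_ssubset_irr A : ~ almost_ssubset A A.
Proof. by rewrite almost_ssubsetP => -[/not_cofinal]. Qed.

Lemma almost_ssubset_trans A B C :
  almost_ssubset A B -> almost_ssubset B C -> almost_ssubset A C.
Proof.
rewrite !almost_ssubsetP => -[bAB cBA] [bBC cCB]; split.
  apply: boundedS (bounded_setU bAB bBC) => x [Ax nCx].
  by have [Bx|nBx] := pselect (B x); [right|left].
apply: cofinalS (cofinal_setD cCB bAB) => x [[Cx nBx] nABx]; split=> // Ax.
exact: nABx.
Qed.

Lemma almost_ssubset_cofinal A B : almost_ssubset A B -> cofinal B.
Proof. by rewrite almost_ssubsetP => -[_]; apply: cofinalS => x []. Qed.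

(** * Sparse sets and disjoint cofinal families *)

(** Asking for the bound at all [z <= x], and not just at [x], allows an arbitrary [f] to be bounded
    at points outside [D]. *)
Definition sparse f D : Prop :=
  forall x y z, D x -> D y -> x < y -> z <= x -> f z < y.

(** Greedy chain for the relation that makes [D] sparse, where stage [a] asks for a point of [X]
    above [a]. If [D] were bounded by [b], then [f] would be bounded below [b] by regularity, and a
    large point of [X] would lie above the whole chain. *)
Lemma sparse_subset f X : cofinal X ->
  exists D, [/\ D `<=` X, cofinal D & sparse f D].
Proof.
move=> cX; pose R (x y : K) := x < y /\ forall z, z <= x -> f z < y.
have Rirr x : ~ R x x by rewrite /R ltxx => -[].
have Rtrans x y z : R x y -> R y z -> R x z.
  move=> [xy fy] [yz fz]; split=> [|t tx]; first exact: lt_trans yz.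
  exact: lt_trans (fy _ tx) yz.
have [D [[_ _ Dtot _] _ DQ Dgreedy]] :=
  greedy_chain (fun a => [set x | X x /\ a <= x]) Rirr Rtrans.
exists D; split=> [x /DQ[a _ []//]| |x y z Dx Dy xy zx].
  apply: contrapT => nD; have /not_cofinal[b Db] := nD; apply: nD => a.
  have [[x [Dx [_ ax]]]|no] := Dgreedy a; first by exists x.
  have [c fc] := segment_bounded b f.
  have [x Xx] := cX (Order.max a (Order.max b c)).
  rewrite !ge_max => /and3P[ax bx cx].
  case: (no x) => // w /Db wb.
  split=> [|z zw]; first exact: lt_le_trans bx.
  apply: lt_le_trans cx; apply: fc; exact: le_trans zw (ltW wb).
have [xE|[_ fy]|[yx _]] := Dtot _ _ Dx Dy; last 1 first.
- by have := lt_trans xy yx; rewrite ltxx.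
- by move: xy; rewrite xE ltxx.
- exact: fy.
Qed.

(* Between two consecutive points x < y of a sufficiently sparse set there is
   room for an injective image of the segment below x; E i collects the images
   of i. *)
Lemma disjoint_cofinal_family X : cofinal X -> exists E : K -> set K,
  [/\ forall i, E i `<=` X, forall i, cofinal (E i)
    & forall i j x, E i x -> E j x -> i = j].
Proof.
move=> cX; have /choice[e eP] (x : K) : exists e : K -> K,
    injective e /\ forall i, X (e i) /\ x < e i.
  have : [set: K] #<= [set y | X y /\ x < y].
    have : full_subset [set y | X y /\ x < y].
      apply/full_cofinal => a; have [y Xy] := cofinal_gt (Order.max a x) cX.
      by rewrite gt_max => /andP[/ltW ay xy]; exists y.
    by rewrite /full_subset card_eq_le => /andP[].
  move=> /card_le_relP[r [rtot rinj]].
  have /choice[e er] i : exists y, [/\ X y, x < y & r i y].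
    by have [//|y [Xy xy] riy] := rtot i; exists y.
  exists e; split=> [i j eij|i]; last by have [] := er i.
  have [_ _ ri] := er i; have [_ _ rj] := er j.
  by apply: (rinj _ _ (e i)) => //; rewrite eij.
(* [f x] exceeds every [e x i] with [i <= x], so in an [f]-sparse set these images end before the
   next point. *)
have /choice[f fP] x := segment_bounded x (e x).
have [D [DX cD Dsp]] := sparse_subset f cX.
exists (fun i => [set y | exists x, [/\ D x, i <= x & e x i = y]]); split.
- by move=> i _ [x [_ _ <-]]; have [_ /(_ i)[]] := eP x.
- move=> i a; have [x Dx] := cD (Order.max a i).
  rewrite ge_max => /andP[ax ix]; exists (e x i); first by exists x.
  by have [_ /(_ i)[_ /ltW]] := eP x; exact: le_trans.
- have sep x x' i j : D x -> D x' -> i <= x -> x < x' -> e x i < e x' j.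
    move=> Dx Dx' ix xx'; apply: lt_trans (fP _ _ ix) _.
    have [_ /(_ j)[_]] := eP x'; apply: lt_trans.
    exact: Dsp xx' (lexx _).
  move=> i j _ [x [Dx ix <-]] [x' [Dx' jx' eE]].
  have [xx'|x'x|xE] := ltgtP x x'.
  + by have := sep x x' i j Dx Dx' ix xx'; rewrite eE ltxx.
  + by have := sep x' x j i Dx' Dx jx' x'x; rewrite eE ltxx.
  + by subst x'; have [einj _] := eP x; apply: einj.
Qed.

(** * Chains and towers for almost inclusion *)

Lemma well_ordered_range {T : Type} (R : T -> T -> Prop) (A : K -> T) :
  (forall x, ~ R x x) -> (forall x y z, R x y -> R y z -> R x z) ->
  (forall i j, i < j -> R (A i) (A j)) -> well_ordered_by R (range A).
Proof.
move=> Rirr Rtrans AR; have [[Kwo _] _ _] := regK.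
split=> [x _|x y z _ _ _|_ _ [i _ <-] [j _ <-]|S SA [x Sx]].
- exact: Rirr.
- exact: Rtrans.
- have [ij|ji|->] := ltgtP i j; last by constructor 1.
    by constructor 2; exact: AR.
  by constructor 3; exact: AR.
- have [|m [[Sm mmin] _]] := Kwo (mem [set i | S (A i)]).
    by have [i _ Ai] := SA _ Sx; exists i; apply/mem_set; rewrite /= Ai.
  exists (A m); first exact/set_mem.
  move=> y Sy; have [i _ Ai] := SA _ Sy.
  have : m <= i by apply/mmin/mem_set; rewrite /= Ai.
  by rewrite le_eqVlt -Ai => /predU1P[->|/AR]; [left|right].
Qed.

(** The complement of [A i] is the union of the disjoint pieces [E j] with [i < j]. It shrinks as
    [i] grows, and [E j] is gained on passing from [A i] to [A j]. *)
Lemma long_chain X : cofinal X -> exists A : K -> set K,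
  [/\ forall i j, i < j -> almost_ssubset (A i) (A j),
      forall i, cofinal (A i) & forall i, ~` A i `<=` X].
Proof.
move=> /disjoint_cofinal_family[E [EX cE Edisj]].
exists (fun i => ~` [set x | exists2 j, i < j & E j x]); split.
- move=> i j ij; apply/almost_ssubsetP; split.
    apply: boundedS bounded0 => x [nix njx]; apply: njx => -[k jk Ekx].
    by apply: nix; exists k => //; exact: lt_trans jk.
  apply: cofinalS (cE j) => x Ejx; split.
    by move=> [k jk /(Edisj _ _ _ Ejx) jE]; move: jk; rewrite jE ltxx.
  by move=> /(_ _); apply; exists j.
- move=> i; apply: cofinalS (cE i) => x Eix [j ij /(Edisj _ _ _ Eix) iE].
  by move: ij; rewrite iE ltxx.
- by move=> i x; rewrite setCK => -[j _ /EX].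
Qed.

(** Take two disjoint cofinal pieces outside [C]: a sparse subset of one becomes the complement of
    [C'], and the other lies in [C'] and makes the inclusions strict. *)
Lemma extend_chain f (W : set (set K)) C :
  cofinal (~` C) -> (forall A, W A -> bounded (A `\` C)) ->
  exists C', sparse f (~` C') /\ forall A, W A -> almost_ssubset A C'.
Proof.
move=> cC WC; have [E [EC cE Edisj]] := disjoint_cofinal_family cC.
have [i _] := ex_point; have [j ij] := exists_gt i.
have [D [DE cD Dsp]] := sparse_subset f (cE i).
exists (~` D); rewrite setCK; split=> // A /WC bAC; apply/almost_ssubsetP; split.
  by apply: boundedS bAC => x [Ax /contrapT /DE /EC nCx].
apply: cofinalS (cofinal_setD (cE j) bAC) => x [Ejx nACx]; split.
  by move=> /DE /(Edisj _ _ _ Ejx) jE; move: ij; rewrite jE ltxx.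
by move=> Ax; apply: nACx; split=> //; exact: EC Ejx.
Qed.

Lemma not_tower_bound (W : set (set K)) :
  W `<=` @full_subset d K -> [set: K] #<= W ->
  well_ordered_by (@almost_ssubset d K) W -> ~ tower W ->
  exists2 C, cofinal (~` C) & forall A, W A -> bounded (A `\` C).
Proof.
move=> Wfull KW Wwo nW; apply: contrapT => no; apply: nW; split=> // C _ fC.
apply: contrapT => noA; apply: no; exists C; first exact/full_cofinal.
move=> A WA; apply/not_cofinal => /full_cofinal fAC; apply: noA.
by exists A.
Qed.

(** A greedy chain is put on top of the fixed chain [A] by admitting only candidates above every
    [A k]. The range of [A] supplies the required size, and [W] stays bounded by the indices with a
    candidate. *)
Lemma greedy_tower (I : Type) (Q : I -> set (set K)) (A : K -> set K) :
  (forall i j, i < j -> almost_ssubset (A i) (A j)) ->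
  (forall i, cofinal (A i)) ->
  exists W : set (set K),
    [/\ range A `|` W `<=` @full_subset d K,
        [set: K] #<= range A `|` W,
        well_ordered_by (@almost_ssubset d K) (range A `|` W),
        W #<= [set i | Q i !=set0]
      & forall i, (W `&` Q i) !=set0 \/
          forall C, Q i C ->
            ~ (forall B, (range A `|` W) B -> almost_ssubset B C)].
Proof.
move=> Alt cA.
pose Q' i := [set C | Q i C /\ forall k, almost_ssubset (A k) C].
have [W [Wwo WQ WU Wgreedy]] :=
  greedy_chain Q' almost_ssubset_irr almost_ssubset_trans.
have AW k C : W C -> almost_ssubset (A k) C by move=> /WU[i _ [_]]; exact.
exists W; split.
- have [k0 _] := ex_point; move=> C AWC; apply/full_cofinal.
  by case: AWC => [[k _ <-]//|/(AW k0)]; exact: almost_ssubset_cofinal.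
- apply: card_le_trans (subset_card_le (@subsetUl _ _ _)).
  apply/card_le_relP; exists (fun k C => A k = C); split=> [k _|i j _ <- ji].
    by exists (A k) => //; exists k.
  have [ij|ij|//] := ltgtP i j; have := Alt _ _ ij; rewrite ji;
    by move/almost_ssubset_irr.
- apply: well_ordered_by_setU (Wwo) _; [exact: almost_ssubset_trans| |].
    apply: well_ordered_range Alt; first exact: almost_ssubset_irr.
    exact: almost_ssubset_trans.
  by move=> _ C [k _ <-]; exact: AW.
- by apply: card_le_trans WQ _; apply: subset_card_le => i [C [QC _]]; exists C.
- move=> i; have [[C [WC [QC _]]]|no] := Wgreedy i; [left|right].
    by exists C.
  move=> C QC WC; apply: (no C) => [|B WB]; last by apply: WC; right.
  by split=> // k; apply: WC; left; exists k.
Qed.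

(** With every singleton as a candidate set, nothing can lie above the whole chain; if the chain
    were no tower, [extend_chain] would give such a set. *)
Lemma ex_tower : exists T, @tower d K T.
Proof.
have [A [Alt cA _]] := long_chain cofinalT.
have [W [Wfull KW Wwo _ Wgreedy]] := greedy_tower (fun C => [set C]) Alt cA.
exists (range A `|` W); apply: contrapT => nT.
have [C cC WC] := not_tower_bound Wfull KW Wwo nT.
have [C' [_ C'W]] := extend_chain id cC WC.
have [[B [WB BC']]|/(_ C' erefl)] := Wgreedy C'; last exact.
rewrite BC' in WB; by apply: (@almost_ssubset_irr C'); apply: C'W; right.
Qed.

(** * Towers against unbounded families *)

Lemma not_eventually_lt_irr f : ~ eventually_lt f f.
Proof. by move=> [b fb]; have [a /fb] := exists_gt b; rewrite ltxx. Qed.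

(** By regularity, a family too small to contain a copy of [K] is bounded pointwise. *)
Lemma card_le_unbounded (F : set (K -> K)) :
  unbounded_family F -> [set: K] #<= F.
Proof.
move=> unbF; apply: contrapT => KF.
have /choice[f fP] a := small_bounded (fun g => g a) KF.
have [g Fg] := unbF f; apply; have [b _] := ex_point.
by exists b => a _; exact: fP.
Qed.

(** At [a] it suffices to exceed [h i a] for the indices [i <= a]. *)
Lemma diagonal_bound (h : K -> K -> K) :
  exists f, forall i, eventually_lt (h i) f.
Proof.
have /choice[f fP] a := segment_bounded a (fun i => h i a).
by exists f => i; exists i => a /ltW; exact: fP.
Qed.

Lemma tower_le_unbounded (T : set (set K)) (F : set (K -> K)) :
  (forall S, @tower d K S -> T #<= S) -> unbounded_family F -> T #<= F.
Proof.
move=> Tmin unbF; apply: contrapT => nTF.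
have /card_le_relP[r [rtot rinj]] := card_le_unbounded unbF.
have /choice[h hP] i : exists f, F f /\ r i f.
  by have [//|f] := rtot i; exists f.
have [f0 hf0] := diagonal_bound h.
have [X [_ cX Xsp]] := sparse_subset f0 cofinalT.
have [A [Alt cA AX]] := long_chain cX.
(* No candidates are offered for [f] in the range of [h], so [W] injects into the rest of [F] and
   leaves that range to index [A]. *)
pose Q f := [set C | (F `\` range h) f /\ sparse f (~` C)].
have [W [Wfull KW Wwo WQ Wgreedy]] := greedy_tower Q Alt cA.
have WF : range A `|` W #<= F.
  have -> : F = range h `|` (F `\` range h).
    by rewrite setDUK// => _ [i _ <-]; have [] := hP i.
  apply: card_le_setU; last by rewrite setDIK.
    apply: card_le_trans (card_image_le _ _) _.
    apply/card_le_relP; exists (fun i f => h i = f); split=> [i _|i j _ <- ij].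
      by exists (h i) => //; exists i.
    have [_ ri] := hP i; have [_ rj] := hP j.
    by apply: (rinj _ _ (h i)) => //; rewrite -ij.
  by apply: card_le_trans WQ _; apply: subset_card_le => f [C []].
have [C cC WC] : exists2 C, cofinal (~` C) &
    forall B, (range A `|` W) B -> bounded (B `\` C).
  apply: not_tower_bound => // towW; apply: nTF.
  exact: card_le_trans (Tmin _ towW) WF.
have WF' f : F f -> exists2 B, (range A `|` W) B &
    exists2 g, sparse g (~` B) & f = g \/ eventually_lt f g.
  move=> Ff; have [[i _ <-]|nhf] := pselect (range h f).
    exists (A i); first by left; exists i.
    exists f0; last by right.
    by move=> x y z /AX Xx /AX; exact: Xsp.
  (* Stage [f] cannot have failed: [C] almost contains the chain, so [extend_chain] yields a
     candidate above all of it. *)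
  have [[B [WB [_ Bsp]]]|no] := Wgreedy f.
    by exists B; [right|exists f => //; left].
  have [C' [C'sp C'W]] := extend_chain f cC WC.
  by case: (no C').
have /choice[g gP] a : exists y, exists x,
    [/\ (~` C) x, (~` C) y, a <= x & x < y].
  have [x Cx ax] := cC a; have [y Cy xy] := cofinal_gt x cC.
  by exists y, x.
have [f /WF'[B /WC[b bB] [f' Bsp ff']]] := unbF g; apply.
have [c fc] : exists c, forall a, c < a -> f a <= f' a.
  case: ff' => [->|[c fc]]; first by exists b.
  by exists c => a /fc /ltW.
(* Past [b], the points [x < g a] of the complement of [C] also avoid [B]; as [a <= x], sparseness
   gives [f' a < g a]. *)
exists (Order.max b c) => a; rewrite gt_max => /andP[ba ca].
have [x [Cx Cy ax xy]] := gP a.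
have nB z : (~` C) z -> a <= z -> (~` B) z.
  move=> Cz az Bz; have := bB z (conj Bz Cz).
  by rewrite ltNge (le_trans (ltW ba) az).
apply: le_lt_trans (fc _ ca) _; apply: (Bsp x) => //; first exact: (nB x).
by apply: (nB (g a)) => //; exact: le_trans ax (ltW xy).
Qed.

End RegularCardinal.

Theorem lemma1 (d : Order.disp_t) (K : orderType d)
    (regK : regular_cardinal K) :
  [/\ exists T : set (set K), represents_t T,
      exists B : set (K -> K), represents_b B
    & forall (T : set (set K)) (B : set (K -> K)),
        represents_t T -> represents_b B -> T #<= B].
Proof.
split; first exact/ex_least_card/ex_tower.
  apply: ex_least_card; exists setT => f; exists f => //.
  exact: not_eventually_lt_irr.
by move=> T B [_ Tmin] [unbB _]; exact: tower_le_unbounded.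
Qed.
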